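(* Let $G$ be a connected 1-plane graph without $\times$-crossings (satisfying the kite-edge standing assumption below), and let $k\ge 1$ be an integer. Then $G$ has a separating set of size at most $k$ if and only if the radial planarization $\Lambda(G)$ has a co-separating triple $(A,X,B)$ such that $|X\cap V(G)|\le k$ and the subgraph of $\Lambda(G)$ induced by $X$ has diameter at most $4k$.
   Context: Graphs are connected, have no loops, and may have parallel edges. A 1-plane graph is a graph $G$ together with a drawing in the plane that is good (edges are simple curves; two edges intersect only at a common endpoint or at a proper crossing; any two edges intersect at most once; no three edges cross at one point) and in which every edge is crossed at most once. For a crossing of edges $(u,v)$ and $(w,x)$, the four distinct vertices $u,v,w,x$ are its endpoints; two endpoints are consecutive if they are not $\{u,v\}$ and not $\{w,x\}$. The crossing is an $\times$-crossing if no two consecutive endpoints are adjacent in $G$. The planarization $G^\times$ is the plane graph obtained by replacing each crossing point by a new dummy vertex adjacent to the four endpoints of that crossing. An edge of $G$ joining consecutive endpoints $u,x$ of a crossing with dummy vertex $c$ is a kite edge if it is uncrossed and $G^\times$ has a face bounded exactly by this edge and the edges $(u,c),(c,x)$. Standing assumption: for every crossing and every pair of consecutive endpoints that are adjacent in $G$, some edge joining them is a kite edge of that crossing. The radial planarization $\Lambda(G)$ is the plane graph obtained from $G^\times$ by inserting a new face vertex $f_F$ inside each face $F$ of $G^\times$ and, for each occurrence of a vertex $v$ on the boundary walk of $F$, an edge $(v,f_F)$ drawn inside $F$ (repeated occurrences give parallel edges). A $G$-vertex is a vertex of $V(G)$. A separating set of $G$ is a set $S\subseteq V(G)$ such that $G-S$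 is disconnected. If $\Lambda$ is a graph sharing some vertices with $G$, a co-separating triple of $\Lambda$ is a partition $(A,X,B)$ of $V(\Lambda)$ such that each of $A,X,B$ contains at least one $G$-vertex, and for all $a\in A$, $b\in B$ there is no edge $(a,b)$ in $E(\Lambda)$ nor in $E(G)$. *)

(* Defs.v *)
(* A 1-plane graph is encoded by a combinatorial map
   (rotation system) of its planarization G^x. *)
From HB Require Import structures.
From mathcomp Require Import all_boot fingroup perm.
Set Implicit Arguments. Unset Strict Implicit. Unset Printing Implicit Defensive.

Section OnePlane.
(* V : vertices of G;  C : crossings (= dummy vertices of G^x);
   D : darts (half-edges) of the plane map G^x;
   vert d : vertex of G^x at which dart d starts;
   alpha  : opposite dart of the same edge of G^x;
   sigma  : rotation (cyclic order of darts around each vertex). *)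
Variables (V C D : finType) (vert : D -> V + C) (alpha sigma : {perm D}).

Definition head (d : D) : V + C := vert (alpha d).

(* face permutation; faces of G^x are the phi-orbits *)
Definition phi (d : D) : D := sigma (alpha d).

(* G^x is a connected plane map with the structure of a planarization of a
   good 1-plane drawing *)
Definition one_plane_map : Prop :=
  [/\ (forall d, alpha (alpha d) = d /\ alpha d != d),
      (forall d, vert (sigma d) = vert d),
      (forall d d', vert d = vert d' -> fconnect sigma d d'),
      (forall d, head d != vert d) &
   [/\ (forall c : C, exists d, vert d = inr c),
      (forall d (c : C), vert d = inr c ->
          fingraph.order sigma d = 4 /\
          (forall i, i < 4 -> exists u : V, head (iter i sigma d) = inl u) /\
          uniq [seq head (iter i sigma d) | i <- iota 0 4])     & (0 < #|D| -> #|{: V + C}|.*2 + (fcard phi {: D}).*2 = #|D| + 4)]].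

(* adjacency in G: an uncrossed edge (an edge of G^x between two G-vertices)
   or a crossed edge u - c - v through a dummy vertex c (opposite darts) *)
Definition adjG : rel V := fun u v =>
  [exists d, (vert d == inl u) &&
     match head d with
     | inl w => w == v
     | inr _ => head (iter 2 sigma (alpha d)) == inl v
     end].

Definition adjGW : rel (V + C) := fun a b =>
  match a, b with inl u, inl v => adjG u v | _, _ => false end.

Definition G_connected : Prop := forall u v : V, connect adjG u v.

(* endpoints of a crossing c, in rotation order, starting from a dart d at c:
   head (iter i sigma d), i = 0..3; consecutive ones are i, i+1 (mod 4) *)
Definition no_x_crossings : Prop :=
  forall d (c : C), vert d = inr c ->
    exists2 i, i < 4 &
      adjGW (head (iter i sigma d)) (head (iter i.+1 sigma d)).

(* the edge of G^x carrying dart d0 (an uncrossed edge of G between G-vertices)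
   is a kite edge of crossing c: some dart of it lies on a face of G^x bounded
   by exactly three edges, the third vertex of which is c *)
Definition kite_edge (c : C) (d0 : D) : Prop :=
  exists2 d, d \in [:: d0; alpha d0] &
    fingraph.order phi d = 3 /\ head (phi d) = inr c.

Definition kite_assumption : Prop :=
  forall d (c : C), vert d = inr c -> forall i, i < 4 ->
    adjGW (head (iter i sigma d)) (head (iter i.+1 sigma d)) ->
    exists d0, [/\ vert d0 = head (iter i sigma d),
                   head d0 = head (iter i.+1 sigma d) & kite_edge c d0].

Definition faceT := {d : D | froot phi d == d}.

Definition LV := ((V + C) + faceT)%type.

Definition adjL : rel LV := fun a b =>
  match a, b with
  | inl w, inl w' => [exists d, (vert d == w) && (head d == w')]
  | inl w, inr f => [exists d, (vert d == w) && (froot phi d == val f)]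
  | inr f, inl w => [exists d, (vert d == w) && (froot phi d == val f)]
  | inr _, inr _ => false
  end.

Definition adjGL : rel LV := fun a b =>
  match a, b with inl (inl u), inl (inl v) => adjG u v | _, _ => false end.

Definition co_separating_triple (A X B : {set LV}) : Prop :=
  [/\ [/\ ([disjoint A & X]), ([disjoint A & B]), ([disjoint X & B]) &
          A :|: X :|: B = setT],
      [/\ (exists v : V, inl (inl v) \in A),
          (exists v : V, inl (inl v) \in X) &
          (exists v : V, inl (inl v) \in B)]
    & forall a b, a \in A -> b \in B -> ~~ adjL a b && ~~ adjGL a b].

Definition induced_diam_le (X : {set LV}) (n : nat) : Prop :=
  forall x y, x \in X -> y \in X ->
    exists p : seq LV,
      [/\ path (fun a b => adjL a b && (a \in X) && (b \in X)) x p,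
          last x p = y & size p <= n].

Definition separating (S : {set V}) : Prop :=
  exists u v, [/\ u \notin S, v \notin S &
    ~~ connect (fun x y => [&& adjG x y, x \notin S & y \notin S]) u v].

End OnePlane.

(* Main.v *)
(* Backward, X ∩ V(G) separates. Forward, shrink S to a minimal separating set;
   then every s in S has neighbours in every component of G - S. Let X consist of
   S, the dummies with an endpoint in S, and the faces incident to one of these.
   A crossing avoiding S has all endpoints in one component of G - S (this is
   where the absence of x-crossings enters), hence so has a face avoiding X, and X
   separates the components in Lambda(G). Every vertex of X is within distance 2
   of S, and the faces, the only ones at distance 2, are pairwise nonadjacent, so
   the diameter bound 4k follows once Lambda[X] is known to be connected.

   For connectedness, let W be the planarization of one component K of G - S and
   Z the connected component of G^x - W containing another component of G - S.
   Every edge of the cut between Z and its complement has an end in X. If X split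
   into two nonadjacent parts, all cut edges on a given face would touch the same
   part, so the cut edges touching one part would form a cocycle over F_2. By
   Euler's formula this cocycle is a coboundary, of a function constant on Z and
   on the complement of Z, so it is empty or the whole cut. But each s in S lies
   near some cut edge. *)
Require Import Defs.
From mathcomp Require Import all_boot fingroup perm all_algebra zify.
Set Implicit Arguments. Unset Strict Implicit. Unset Printing Implicit Defensive.
Import GRing.Theory.

(** * Exactness for spherical maps *)

Section Exactness.
Local Open Scope ring_scope.

(** The kernel lies in the line spanned by the all-ones row, so its dimension is at most 1. *)
Lemma rank_const_ker (K : fieldType) (n e : nat) (M : 'M[K]_(n, e)) :
  (forall h : 'rV_n, h *m M = 0 -> forall i j, h 0 i = h 0 j) ->
  (n <= (\rank M).+1)%N.
Proof.
move=> kerM.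
have sub1: (kermx M <= (const_mx 1 : 'rV[K]_n))%MS.
  apply/row_subP=> i; have := kerM (row i (kermx M)).
  rewrite -row_mul mulmx_ker row0 => /(_ erefl) hconst.
  apply/sub_rVP; exists (row i (kermx M) 0 i); apply/rowP=> j.
  by rewrite (hconst j i) !mxE mulr1.
have := leq_trans (mxrankS sub1) (rank_leq_row _).
by rewrite mxrank_ker leq_subLR addn1.
Qed.

(** The image of [M] lies in the kernel of [M'], whose dimension is at most e - (f - 1) = n - 1,
    hence at most the rank of [M]; so the two coincide. *)
Lemma exact_of_euler (K : fieldType) (n e f : nat)
    (M : 'M[K]_(n, e)) (M' : 'M[K]_(e, f)) :
  M *m M' = 0 -> (n + f = e.+2)%N ->
  (forall h : 'rV_n, h *m M = 0 -> forall i j, h 0 i = h 0 j) ->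
  (forall u : 'cV_f, M' *m u = 0 -> forall i j, u i 0 = u j 0) ->
  forall g : 'rV_e, g *m M' = 0 -> exists h : 'rV_n, g = h *m M.
Proof.
move=> MM' euler kerM kerM' g gM'.
have rM := rank_const_ker kerM.
have: (f <= (\rank M').+1)%N.
  rewrite -mxrank_tr; apply: rank_const_ker => u /(congr1 trmx).
  rewrite trmx_mul trmxK trmx0 => /kerM' hu i j.
  by have := hu i j; rewrite !mxE.
move=> rM'.
have sM : (M <= kermx M')%MS by apply/sub_kermxP.
have [_ /esym rE] := mxrank_leqif_eq sM.
have: (\rank (kermx M') <= \rank M)%N.
  rewrite mxrank_ker; move: rM rM' euler (rank_leq_row M'); lia.
move=> le_r; have: (kermx M' <= M)%MS.
  have := rE; rewrite eqn_leq le_r mxrankS //= => /andP[_ ->] //.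
move=> sK; have: (g <= M)%MS by apply: submx_trans sK; apply/sub_kermxP.
by case/submxP=> h ->; exists h.
Qed.

Lemma F2_add_eq0 (x y : 'F_2) : (x + y == 0) = (x == y).
Proof. by rewrite addr_eq0 oppr_pchar2 // pchar_Fp. Qed.

(** * The chain complex of a combinatorial map over F_2 *)

Section Map.
Variables (N D : finType) (vert : D -> N) (alpha sigma : {perm D}).
Hypothesis alphaK : involutive alpha.
Hypothesis alpha_neq : forall d, alpha d != d.
Hypothesis vert_sigma : forall d, vert (sigma d) = vert d.
Hypothesis vert_surj : forall x, exists d, vert d = x.
(** Transitivity of the group generated by [sigma] and [alpha], phrased through invariant functions,
    as the kernel computations use it. *)
Hypothesis map_connected : forall (T : eqType) (P : D -> T),
  (forall d, P (sigma d) = P d) -> (forall d, P (alpha d) = P d) ->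
  forall d d', P d = P d'.
Hypothesis euler : (#|N|.*2 + (fcard (phi alpha sigma) D).*2 = #|D| + 4)%N.

Notation phi := (phi alpha sigma).

Let E : pred D := [pred d | (enum_rank d < enum_rank (alpha d))%N].

Lemma phi_inj : injective phi.
Proof. by move=> x y /perm_inj /perm_inj. Qed.

Lemma orientE d : E (alpha d) = ~~ E d.
Proof.
rewrite /E /= alphaK -leqNgt [RHS]leq_eqVlt orbC.
by case: eqP => [/ord_inj/enum_rank_inj/eqP|]; rewrite ?orbF // (negPf (alpha_neq d)).
Qed.

Lemma sum_orient (R : nmodType) (F : D -> R) :
  \sum_d F d = \sum_(d in E) (F d + F (alpha d)).
Proof.
rewrite (bigID E) /= big_split /=; congr (_ + _).
rewrite (reindex_inj (@perm_inj _ alpha)) /=; apply: eq_bigl => d.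
by rewrite (orientE d) negbK.
Qed.

Lemma card_orient : (#|D| = #|E|.*2)%N.
Proof.
transitivity (\sum_(d : D) 1)%N; first by rewrite sum1_card.
by rewrite (sum_orient (fun=> 1%N)) sum_nat_const muln2.
Qed.

Lemma froot_phi d : froot phi (phi d) = froot phi d.
Proof.
apply/eqP; rewrite (root_connect (fconnect_sym phi_inj)).
by rewrite fconnect_sym ?fconnect1 //; exact: phi_inj.
Qed.

Let vtx (i : 'I_#|N|) : N := enum_val i.
Let edg (j : 'I_#|E|) : D := enum_val j.
Let fac (l : 'I_#|froots phi|) : D := enum_val l.

Let a x d : 'F_2 := (vert d == x)%:R.
Let b f d : 'F_2 := (froot phi d == f)%:R.

(** [M] is the vertex-edge coboundary and [M'] the edge-face one; an edge with the same face on both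
    sides gets entry 0 in [M']. *)
Let M : 'M['F_2]_(#|N|, #|E|) :=
  \matrix_(i, j) (a (vtx i) (edg j) + a (vtx i) (alpha (edg j))).
Let M' : 'M['F_2]_(#|E|, #|froots phi|) :=
  \matrix_(j, l) (b (fac l) (edg j) + b (fac l) (alpha (edg j))).

Lemma sum_edg (R : nmodType) (F : D -> R) :
  \sum_j F (edg j) = \sum_(d in E) F d.
Proof. by rewrite [RHS]big_enum_val. Qed.

(** [phi] matches the darts entering x along a face f with those leaving x along f, so f meets the
    edges at x an even number of times. *)
Lemma coboundary_closed : M *m M' = 0.
Proof.
apply/matrixP=> i l; rewrite !mxE.
under eq_bigr do rewrite !mxE.
set x := vtx i; set f := fac l.
rewrite (sum_edg (fun d => (a x d + a x (alpha d)) * (b f d + b f (alpha d)))).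
transitivity (\sum_d a x d * (b f d + b f (alpha d))).
  rewrite sum_orient; apply: eq_bigr => d _.
  by rewrite alphaK [b f (alpha d) + _]addrC -mulrDl.
under eq_bigr do rewrite mulrDr.
rewrite big_split /=; apply/eqP; rewrite F2_add_eq0; apply/eqP.
rewrite (reindex_inj phi_inj) [RHS](reindex_inj (@perm_inj _ alpha)) /=.
apply: eq_bigr => d _; rewrite alphaK /a /b froot_phi; congr (_%:R * _).
by rewrite /phi vert_sigma.
Qed.

Lemma coboundary_ker (h : 'rV_#|N|) : h *m M = 0 -> forall i j, h 0 i = h 0 j.
Proof.
pose H x := h 0 (enum_rank x).
move=> hM; have sumH d : \sum_i h 0 i * a (vtx i) d = H (vert d).
  rewrite (bigD1 (enum_rank (vert d))) //= big1 => [|i ni].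
    by rewrite /a /vtx enum_rankK eqxx mulr1 addr0.
  rewrite /a /vtx -(inj_eq enum_rank_inj) enum_valK eq_sym (negPf ni) mulr0 //.
have HE d : E d -> H (vert d) = H (vert (alpha d)).
  move=> Ed; have := congr1 (fun A : 'rV_#|E| => A 0 (enum_rank_in Ed d)) hM.
  rewrite !mxE; under eq_bigr do rewrite !mxE /edg enum_rankK_in // mulrDr.
  by rewrite big_split /= !sumH => /eqP; rewrite F2_add_eq0 => /eqP.
have HD d d' : H (vert d) = H (vert d').
  apply: (map_connected (P := fun d => H (vert d))) => {}d.
    by rewrite vert_sigma.
  have [/HE //|/negPf nE] := boolP (E d).
  by rewrite (HE (alpha d)) ?alphaK // orientE nE.
move=> i j; have [[d di] [d' dj]] := (vert_surj (vtx i), vert_surj (vtx j)).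
by have := HD d d'; rewrite di dj /H /vtx !enum_valK.
Qed.

(** Dual of [coboundary_ker]: a function on faces that agrees across edges is invariant under
    [alpha] and [phi], hence under [sigma], which is [phi] after [alpha]. *)
Lemma boundary_ker (u : 'cV_#|froots phi|) :
  M' *m u = 0 -> forall i j, u i 0 = u j 0.
Proof.
have rootE d : froot phi d \in froots phi.
  by rewrite inE; apply/eqP/root_root/fconnect_sym/phi_inj.
(* The index [i0] only supplies the default for [enum_rank_in]; without faces there is nothing to
   show. *)
move=> Mu; have [i0 _|no i j] :=
  pickP (fun _ : 'I_#|froots phi| => true); last by have := no i.
pose U d := u (enum_rank_in (rootE (fac i0)) (froot phi d)) 0.
have Ufac i : u i 0 = U (fac i).
  rewrite /U; congr (u _ 0); apply: enum_val_inj; rewrite enum_rankK_in //.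
  exact/esym/eqP/(enum_valP i).
have sumU d : \sum_l b (fac l) d * u l 0 = U d.
  rewrite (bigD1 (enum_rank_in (rootE (fac i0)) (froot phi d))) //= big1 => [|i ni].
    by rewrite /b /fac enum_rankK_in // eqxx mul1r addr0.
  rewrite /b; case: eqP => [eqd|]; last by rewrite mul0r.
  by move: ni; rewrite eqd /fac enum_valK_in eqxx.
have UE d : E d -> U d = U (alpha d).
  move=> Ed; have := congr1 (fun A : 'cV_#|E| => A (enum_rank_in Ed d) 0) Mu.
  rewrite !mxE; under eq_bigr do rewrite !mxE /edg enum_rankK_in // mulrDl.
  by rewrite big_split /= !sumU => /eqP; rewrite F2_add_eq0 => /eqP.
have UA d : U (alpha d) = U d.
  have [/UE //|/negPf nE] := boolP (E d).
  by rewrite (UE (alpha d)) ?alphaK // orientE nE.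
move=> i j; rewrite !Ufac; apply: map_connected => // d.
by rewrite -[in LHS](alphaK d) -/(phi (alpha d)) /U froot_phi -/(U _) UA.
Qed.

(** The first cohomology of the sphere over F_2 vanishes; Euler's formula gives the dimension count.
    An edge with f on both sides contributes twice, hence 0, to the sum at f, as in [M']. *)
Lemma exact_cochain_F2 (g : D -> 'F_2) :
  (forall d, g (alpha d) = g d) ->
  (forall f, \sum_(d | froot phi d == f) g d = 0) ->
  exists h : N -> 'F_2, forall d, g d = h (vert d) + h (vert (alpha d)).
Proof.
move=> gA gF; pose gE : 'rV_#|E| := \row_j g (edg j).
have: gE *m M' = 0.
  apply/rowP=> l; rewrite !mxE; under eq_bigr do rewrite !mxE.
  rewrite (sum_edg (fun d => g d * (b (fac l) d + b (fac l) (alpha d)))).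
  rewrite -[RHS](gF (fac l)) [RHS]big_mkcond sum_orient /=.
  apply: eq_bigr => d _; rewrite gA mulrDr /b.
  by congr (_ + _); case: eqP; rewrite ?mulr1 ?mulr0.
have cardE : (#|N| + #|froots phi| = #|E|.+2)%N.
  have := euler; rewrite card_orient /n_comp_mem.
  have -> : #|[predI froots phi & D]| = #|froots phi|.
    by apply: eq_card => d; rewrite !inE andbT.
  lia.
case/(exact_of_euler coboundary_closed cardE coboundary_ker boundary_ker)=> h gh.
exists (fun x => h 0 (enum_rank x)).
have sumH d : \sum_i h 0 i * a (vtx i) d = h 0 (enum_rank (vert d)).
  rewrite (bigD1 (enum_rank (vert d))) //= big1 => [|i ni].
    by rewrite /a /vtx enum_rankK eqxx mulr1 addr0.
  rewrite /a /vtx -(inj_eq enum_rank_inj) enum_valK eq_sym (negPf ni) mulr0 //.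
have EH d : E d -> g d = h 0 (enum_rank (vert d)) + h 0 (enum_rank (vert (alpha d))).
  move=> Ed; have := congr1 (fun A : 'rV_#|E| => A 0 (enum_rank_in Ed d)) gh.
  rewrite !mxE /edg enum_rankK_in // => ->.
  under eq_bigr do rewrite !mxE /edg enum_rankK_in // mulrDr.
  by rewrite big_split /= !sumH.
move=> d; have [/EH //|/negPf nE] := boolP (E d).
by rewrite -gA (EH (alpha d)) ?alphaK 1?addrC // orientE nE.
Qed.

End Map.
End Exactness.

(** * Distances in finite graphs *)

Section FiniteRelations.
Variables (T : finType) (e : rel T).

Lemma connect_const (R : Type) (h : T -> R) :
  (forall x y, e x y -> h x = h y) -> forall x y, connect e x y -> h x = h y.
Proof.
move=> he x y /connectP[p]; elim: p x => [|z p IHp] x /=; first by move=> _ ->.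
by case/andP=> /he-> /IHp IH /IH.
Qed.

Lemma connect_exit (P : pred T) x y : connect e x y -> ~~ P x -> P y ->
  exists x1 x2, [/\ connect [rel u v | [&& e u v, ~~ P u & ~~ P v]] x x1,
                    e x1 x2, ~~ P x1 & P x2].
Proof.
case/connectP=> p; elim: p x => [|z p IHp] x /=; first by move=> _ -> /negPf->.
case/andP=> exz pz ly nPx Py; have [Pz|nPz] := boolP (P z).
  by exists x, z.
have [x1 [x2 [cz e12 nP1 P2]]] := IHp z pz ly nPz Py.
exists x1, x2; split=> //; apply: connect_trans cz.
by apply: connect1; rewrite /= exz nPx.
Qed.

(** Length-bounded sequences form a finite type, which makes the distance bound a Boolean. *)
Definition within n x y := [exists p : n.-bseq T, path e x p && (last x p == y)].

Lemma withinP n x y :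
  reflect (exists p, [/\ path e x p, last x p = y & size p <= n]) (within n x y).
Proof.
apply: (iffP existsP) => [[p /andP[ep /eqP ly]]|[p [ep ly sp]]].
  by exists p; split=> //; apply: size_bseq.
by exists (Bseq sp); rewrite /= ep ly eqxx.
Qed.

Lemma within_trans m n x y z : within m x y -> within n y z -> within (m + n) x z.
Proof.
move=> /withinP[p [ep <- sp]] /withinP[q [eq <- sq]]; apply/withinP.
by exists (p ++ q); rewrite cat_path last_cat size_cat ep leq_add.
Qed.

Lemma within_le m n x y : m <= n -> within m x y -> within n x y.
Proof.
move=> lemn /withinP[p [ep lp sp]]; apply/withinP; exists p; split=> //.
exact: leq_trans lemn.
Qed.

Lemma within1 x y : e x y -> within 1 x y.
Proof. by move=> exy; apply/withinP; exists [:: y]; rewrite /= exy. Qed.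

Lemma within0 x : within 0 x x.
Proof. by apply/withinP; exists [::]. Qed.

Lemma within_sym n x y : symmetric e -> within n x y -> within n y x.
Proof.
move=> esym /withinP[p [ep <- sp]]; apply/withinP.
exists (rev (belast x p)); rewrite size_rev size_belast; split=> //.
  by rewrite rev_path; under eq_path do rewrite esym.
by case: p {ep sp} => //= z p; rewrite rev_cons last_rcons.
Qed.

(* Adjacent vertices have total distance at most 3 to S, so walking along a
   path moves the chosen nearest element of S by steps of length at most 4. *)
Lemma diameter_bound (S X : {set T}) (r : T -> nat) : symmetric e ->
  {in S &, forall s s', connect e s s'} ->
  (forall x y, e x y -> y \in X) ->
  (forall x, x \in X -> r x <= 2 /\ exists2 s, s \in S & within (r x) x s) ->
  (forall x y, e x y -> r x + r y <= 3) ->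
  {in X &, forall x y, within (4 * #|S|) x y}.
Proof.
move=> esym connS eX near r3 x y xX yX.
pose H : rel T := [rel s s' | [&& s \in S, s' \in S & within 4 s s']].
(* Going back from [s] to [z], along the edge, and on to [s'] costs at most r z + 1 + r z' <= 4. *)
have step z z' s : e z z' -> s \in S -> within (r z) z s -> z' \in X ->
    exists s', [/\ s' \in S, within (r z') z' s' & H s s'].
  move=> ez sS zs z'X; have [_ [s' s'S z's']] := near _ z'X.
  exists s'; split=> //; rewrite /H /= sS s'S /=.
  apply: within_le (within_trans (within_sym esym zs)
    (within_trans (within1 ez) z's')); have := r3 _ _ ez; lia.
have walk s z : s \in S -> within (r x) x s -> connect e x z -> z \in X ->
    exists s', [/\ s' \in S, within (r z) z s' & connect H s s'].
  move=> + + /connectP[p].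
  elim: p x {xX} s => [|w p IHp] u s /= => [sS us _ -> _|sS us /andP[euw pw] lz zX].
    by exists s.
  have [s1 [s1S ws1 Hs]] := step _ _ _ euw sS us (eX _ _ euw).
  have [s2 [s2S zs2 c12]] := IHp _ _ s1S ws1 pw lz zX.
  by exists s2; split=> //; apply: connect_trans c12; apply: connect1.
have [rx2 [s sS xs]] := near x xX; have [ry2 [s0 s0S ys0]] := near y yX.
have conn_within n u v : within n u v -> connect e u v.
  by case/withinP=> p [ep <- _]; apply/connectP; exists p.
have cxy : connect e x y.
  apply: connect_trans (conn_within _ _ _ xs) _.
  apply: connect_trans (connS _ _ sS s0S) _.
  exact/(conn_within (r y))/within_sym.
have [s' [s'S ys' /connectP[p]]] := walk s y sS xs cxy yX.
case/shortenP=> q Hq uq _ ls'.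
(* The shortened walk is simple and stays in [S], so it has at most #|S| - 1 steps of cost 4; both
   ends cost at most 2, for a total of at most 4 #|S|. *)
have sq : size q < #|S|.
  have subS : {subset s :: q <= S}.
    move=> w; rewrite inE => /predU1P[-> //|].
    elim: q s {sS xs uq ls' walk p} Hq => //= w' q IHq s /andP[/and3P[_ w'S _] Hq].
    by rewrite inE => /predU1P[-> //|]; apply: IHq Hq.
  rewrite -[(size q).+1]/(size (s :: q)) -(card_uniqP uq).
  by apply/subset_leq_card/subsetP.
have ss' : within (4 * size q) s s'.
  rewrite ls'; elim: q s {sS xs uq sq ls' walk p} Hq => [|w q IHq] s /=.
    by rewrite muln0 within0.
  by rewrite mulnS => /andP[/and3P[_ _ sw] /IHq]; apply: within_trans.
apply: within_le (within_trans xs (within_trans ss' (within_sym esym ys'))).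
lia.
Qed.

End FiniteRelations.

(** * Planarizations *)

Section PlaneMap.
Variables (V C D : finType) (vert : D -> V + C) (alpha sigma : {perm D}).
Hypothesis plane : one_plane_map vert alpha sigma.
Hypothesis connG : G_connected vert alpha sigma.

Notation head := (Defs.head vert alpha).
Notation adjG := (adjG vert alpha sigma).
Notation phi := (phi alpha sigma).

Lemma opp_dartK d : alpha (alpha d) = d. Proof. by case: plane => /(_ d)[]. Qed.
Lemma opp_dart_neq d : alpha d != d. Proof. by case: plane => /(_ d)[]. Qed.
Lemma vert_rot d : vert (sigma d) = vert d. Proof. by case: plane. Qed.
Lemma head_opp d : head (alpha d) = vert d.
Proof. by rewrite /Defs.head opp_dartK. Qed.

Lemma vert_iter i d : vert (iter i sigma d) = vert d.
Proof. by elim: i => //= i <-; rewrite vert_rot. Qed.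

Lemma vert_phi d : vert (phi d) = head d.
Proof. by rewrite /Defs.phi vert_rot. Qed.

Lemma dummy_order d c : vert d = inr c -> fingraph.order sigma d = 4.
Proof. by case: plane => _ _ _ _ [_ H _] /H[]. Qed.

Lemma dummy_head d c : vert d = inr c -> exists u, head d = inl u.
Proof. by case: plane => _ _ _ _ [_ H _] /H[_ [/(_ 0 isT)]]. Qed.

Lemma dummy_iter4 d c : vert d = inr c -> iter 4 sigma d = d.
Proof. by move=> /dummy_order <-; apply/iter_order/perm_inj. Qed.

Lemma same_vert_iter d d' : vert d = vert d' ->
  exists2 i, i < fingraph.order sigma d & d' = iter i sigma d.
Proof.
case: plane => _ _ orb _ _ /orb dd'; exists (findex sigma d d').
  exact: findex_max.
by rewrite iter_findex.
Qed.

Lemma adjG_uncrossed u v d : vert d = inl u -> head d = inl v -> adjG u v.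
Proof. by move=> du dv; apply/existsP; exists d; rewrite du dv !eqxx. Qed.

Lemma adjG_crossed u v c d : vert d = inr c -> head d = inl u ->
  head (iter 2 sigma d) = inl v -> adjG u v.
Proof.
move=> dc du dv; apply/existsP; exists (alpha d).
by rewrite head_opp dc opp_dartK -[vert _]/(head d) du dv !eqxx.
Qed.

Lemma adjGP u v : adjG u v ->
  (exists d, vert d = inl u /\ head d = inl v) \/
  (exists d c, [/\ vert d = inr c, head d = inl u &
                   head (iter 2 sigma d) = inl v]).
Proof.
case/existsP=> d /andP[/eqP du]; case dh: (head d) => [w|c] /eqP dv.
  by left; exists d; rewrite dh dv.
by right; exists (alpha d), c; rewrite head_opp.
Qed.

Lemma adjG_sym : symmetric adjG.
Proof.
suff imp u v : adjG u v -> adjG v u by move=> u v; apply/idP/idP; apply: imp.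
case/adjGP=> [[d [du dv]]|[d [c [dc du dv]]]].
  by apply: (@adjG_uncrossed _ _ (alpha d)); rewrite ?head_opp.
apply: (@adjG_crossed _ _ c (iter 2 sigma d)); rewrite ?vert_iter //.
by rewrite -iterD (dummy_iter4 dc).
Qed.

Definition link : rel (V + C) :=
  [rel x y | [exists d, (vert d == x) && (head d == y)]].

Lemma linkP x y : reflect (exists d, vert d = x /\ head d = y) (link x y).
Proof.
apply: (iffP existsP) => [[d /andP[/eqP ? /eqP ?]]|[d [<- <-]]]; exists d => //.
by rewrite !eqxx.
Qed.

Lemma link_sym : symmetric link.
Proof.
suff imp x y : link x y -> link y x by move=> x y; apply/idP/idP; apply: imp.
by move=> /linkP[d [<- <-]]; apply/linkP; exists (alpha d); rewrite head_opp.
Qed.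

(** Connectedness passes from G to the map: a crossed edge of G is a path through its dummy, and
    every dummy has a G-vertex as neighbour. *)
Lemma dart_connected (T : eqType) (P : D -> T) :
  (forall d, P (sigma d) = P d) -> (forall d, P (alpha d) = P d) ->
  forall d d', P d = P d'.
Proof.
move=> Psigma Palpha d0.
have Pvert d d' : vert d = vert d' -> P d = P d'.
  by case/same_vert_iter=> i _ ->; elim: i => //= i ->; rewrite Psigma.
pose Q x := forall d, vert d = x -> P d0 = P d.
have Qvert d : P d0 = P d -> Q (vert d).
  by move=> Pd d' /esym/Pvert <-.
have Qhead d : Q (vert d) -> Q (head d).
  by move=> /(_ _ erefl) dd0; apply: (Qvert (alpha d)); rewrite Palpha.
have [u Qu] : exists u, Q (inl u).
  have := Qvert d0 erefl; case d0v: (vert d0) => [u|c] Q0; first by exists u.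
  by have [u d0u] := dummy_head d0v; exists u; rewrite -d0u; apply: Qhead; rewrite d0v.
have QV v : Q (inl v).
  have /connectP[p] := connG u v; elim: p u Qu => [|w p IHp] u Qu /=.
    by move=> _ ->.
  case/andP=> /adjGP uw; apply: IHp.
  case: uw => [[d [du <-]]|[d [c [dc du <-]]]]; first by apply: Qhead; rewrite du.
  have := Qhead (alpha d); rewrite head_opp -[vert (alpha d)]/(head d) du => Qd.
  by apply: Qhead; rewrite vert_iter; apply: Qd.
move=> d; case dv: (vert d) => [v|c]; first exact: QV dv.
by have [v dv'] := dummy_head dv; rewrite -(Palpha d); apply: QV dv'.
Qed.

(** The dart [d0] rules out a single isolated vertex; connectedness then gives every G-vertex an
    edge. *)
Lemma dart_at (d0 : D) x : exists d, vert d = x.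
Proof.
case: x => [v|c]; last by case: plane => _ _ _ _ [/(_ c)].
have [u [d [du|du]]] : exists u d, vert d = inl u \/ head d = inl u.
- case d0v: (vert d0) => [u|c]; first by exists u, d0; left.
  by have [u d0u] := dummy_head d0v; exists u, d0; right.
- have /connectP[[|w p] /=] := connG v u; first by move=> _ <-; exists d.
  by case/andP=> /existsP[d' /andP[/eqP d'v _]] _ _; exists d'.
have /connectP[[|w p] /=] := connG v u; first by move=> _ <-; exists (alpha d).
by case/andP=> /existsP[d' /andP[/eqP d'v _]] _ _; exists d'.
Qed.

Lemma link_connected (d0 : D) x y : connect link x y.
Proof.
have [dx <-] := dart_at d0 x; have [dy <-] := dart_at d0 y.
have -> : connect link (vert dx) (vert dy) = connect link (vert dx) (vert dx).
  apply: (dart_connected (P := fun d => connect link (vert dx) (vert d))) => d.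
    by rewrite vert_rot.
  rewrite ![connect _ (vert dx) _](sym_connect_sym link_sym).
  apply/(same_connect (sym_connect_sym link_sym))/connect1/linkP.
  by exists (alpha d); rewrite head_opp.
exact: connect0.
Qed.

(* Around a face the boundary of z has even size, so keeping all or none of it
   yields a cocycle. *)
Lemma partial_cut_exact (z : pred (V + C)) (t : pred D) :
  (forall d, t (alpha d) = t d) ->
  (forall d d', froot phi d = froot phi d' -> z (vert d) != z (head d) ->
     z (vert d') != z (head d') -> t d = t d') ->
  exists h : V + C -> 'F_2, forall d,
    ((z (vert d) != z (head d)) && t d)%:R%R = (h (vert d) + h (head d))%R.
Proof.
(* Euler's formula is available only in the presence of a dart; otherwise any [h] works
   vacuously. *)
move=> tA tF; have [d0 _|noD] := pickP (fun _ : D => true); last first.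
  by exists (fun=> 0%R) => d; have := noD d.
have D0 : 0 < #|D| by apply/card_gt0P; exists d0.
have euler : #|{: V + C}|.*2 + (fcard phi D).*2 = #|D| + 4.
  by case: plane => _ _ _ _ [_ _ /(_ D0)].
apply: (@exact_cochain_F2 _ _ vert alpha sigma opp_dartK opp_dart_neq vert_rot
   (dart_at d0) dart_connected euler) => [d|f].
  by rewrite head_opp tA eq_sym.
have [d1 /and3P[/eqP d1f cut1 t1]|none] :=
    pickP [pred d | [&& froot phi d == f, z (vert d) != z (head d) & t d]]; last first.
  rewrite big1 // => d df; have := none d; rewrite /= df /=.
  by case: (_ && _).
(* One cut dart on this face satisfies [t], so all cut darts on it do, and the sum telescopes along
   [phi]. *)
transitivity (\sum_(d | froot phi d == f)
    ((z (vert d))%:R + (z (vert (phi d)))%:R : 'F_2))%R.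
  apply: eq_bigr => d /eqP df; rewrite vert_phi.
  have [cutd|] := boolP (z (vert d) != z (head d)); last first.
    rewrite negbK => /eqP <-; apply/esym/eqP; by rewrite F2_add_eq0.
  rewrite -(tF d1 d) ?df // t1.
  by case: (z (vert d)) (z (head d)) cutd => [] [] //= _; rewrite ?addr0 ?add0r.
rewrite big_split /=; apply/eqP; rewrite F2_add_eq0; apply/eqP.
rewrite [LHS](reindex_inj (@phi_inj _ alpha sigma)) /=.
by apply: eq_bigl => d; rewrite froot_phi.
Qed.

End PlaneMap.

(** * The separator of the radial planarization *)

Section Separator.
Variables (V C D : finType) (vert : D -> V + C) (alpha sigma : {perm D}).
Hypothesis plane : one_plane_map vert alpha sigma.
Hypothesis connG : G_connected vert alpha sigma.
Hypothesis no_x : no_x_crossings vert alpha sigma.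

Notation head := (Defs.head vert alpha).
Notation adjG := (adjG vert alpha sigma).
Notation adjL := (@adjL _ _ _ vert alpha sigma).
Notation adjGL := (@adjGL _ _ _ vert alpha sigma).
Notation phi := (phi alpha sigma).
Notation link := (link vert alpha).
Notation LV := (@LV V C D alpha sigma).

Variable S : {set V}.

Definition avoid : rel V := fun x y => [&& adjG x y, x \notin S & y \notin S].

Lemma avoid_sym : symmetric avoid.
Proof. by move=> x y; rewrite /avoid (adjG_sym plane) andbCA andbC andbA. Qed.

Lemma connect_avoid_notin a x : a \notin S -> connect avoid a x -> x \notin S.
Proof.
move=> aS; apply: contraL => xS; apply/connectP=> -[p pth lst].
case/lastP: p pth lst => [|p y] /=; first by move=> _ xa; rewrite -xa xS in aS.
rewrite last_rcons rcons_path => /andP[_ /and3P[_ _ yS]] xy.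
by rewrite -xy xS in yS.
Qed.

Lemma avoid_comp a x y : avoid x y -> connect avoid a x = connect avoid a y.
Proof.
by move=> xy; apply: (same_connect1r (sym_connect_sym avoid_sym)).
Qed.

Definition hits (x : V + C) :=
  match x with
  | inl u => u \in S
  | inr c => [exists d, (vert d == inr c) &&
                (if head d is inl s then s \in S else false)]
  end.

Lemma hits_dummy d c s : vert d = inr c -> head d = inl s -> s \in S ->
  hits (inr c).
Proof. by move=> dc ds sS; apply/existsP; exists d; rewrite dc eqxx ds. Qed.

Lemma unhit_head d c u : ~~ hits (inr c) -> vert d = inr c -> head d = inl u ->
  u \notin S.
Proof. by move=> nc dc du; apply: contra nc; apply: hits_dummy du. Qed.

(* Without an S-endpoint, both edges at c stay in one component each, and the
   adjacent consecutive endpoints make these two components equal. *)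
Lemma unhit_comp a d d' c u u' : ~~ hits (inr c) -> vert d = inr c ->
  vert d' = inr c -> head d = inl u -> head d' = inl u' ->
  connect avoid a u = connect avoid a u'.
Proof.
move=> nc dc d'c du d'u'.
pose k e := if head e is inl w then connect avoid a w else false.
have vi i : vert (iter i sigma d) = inr c by rewrite (vert_iter plane).
have step i j w w' : head (iter i sigma d) = inl w ->
    head (iter j sigma d) = inl w' -> adjG w w' ->
    k (iter i sigma d) = k (iter j sigma d).
  move=> iw jw' ww'; rewrite /k iw jw'; apply: avoid_comp.
  by rewrite /avoid ww' (unhit_head nc (vi _) iw) (unhit_head nc (vi _) jw').
have opp i : k (iter i sigma d) = k (iter i.+2 sigma d).
  have [[w iw] [w' jw']] := (dummy_head plane (vi i), dummy_head plane (vi i.+2)).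
  by apply: (step _ _ _ _ iw jw'); apply: (adjG_crossed plane (vi i) iw).
have kc i : k (iter i sigma d) = k (iter i.+1 sigma d).
  have [j _ adj] := no_x dc.
  have [[w iw] [w' jw']] := (dummy_head plane (vi j), dummy_head plane (vi j.+1)).
  have kj : k (iter j sigma d) = k (iter j.+1 sigma d).
    by move: adj; rewrite iw jw'; apply: step.
  (* Opposite darts agree, so [k] depends only on the parity of the index; the adjacent pair [j],
     [j.+1] identifies the two parities. *)
  have par n m : k (iter (n + m.*2) sigma d) = k (iter n sigma d).
    by elim: m => [|m IHm]; rewrite ?addn0 // doubleS !addnS -opp.
  have red n : k (iter n sigma d) = k (iter (odd n) sigma d).
    by rewrite -{1}(odd_double_half n) par.
  rewrite red [RHS]red; move: kj; rewrite red [RHS]red /=.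
  by case: (odd i) (odd j) => [] [] //= ->.
have [i _ d'i] := same_vert_iter plane (etrans dc (esym d'c)).
have : k d = k d' by rewrite d'i; elim: i {d'i} => //= i ->; apply: kc.
by rewrite /k du d'u'.
Qed.

Definition separator : {set LV} :=
  [set x : LV | match x with
                | inl w => hits w
                | inr f => [exists d, (froot phi d == val f) && hits (vert d)]
                end].

Lemma face_proof d : froot phi (froot phi d) == froot phi d.
Proof. by rewrite root_root //; apply/fconnect_sym/phi_inj. Qed.

Definition face d : faceT alpha sigma := exist _ (froot phi d) (face_proof d).

Lemma face_phi d : face (phi d) = face d.
Proof. by apply: val_inj; rewrite /= froot_phi. Qed.

Lemma adjL_face d : adjL (inl (vert d)) (inr (face d)).
Proof. by apply/existsP; exists d; rewrite !eqxx. Qed.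

Lemma adjL_sym : symmetric adjL.
Proof. by case=> [x|f] [y|f'] //=; apply: (link_sym plane). Qed.

(** * The co-separating triple of a separating set *)

Section Triple.
Variables a b : V.
Hypothesis aS : a \notin S.
Hypothesis ab : ~~ connect avoid a b.

(** Edges of G are added to those of Lambda(G) because a co-separating triple allows neither between
    its sides. *)
Definition joined : rel LV := fun x y =>
  [&& adjL x y || adjGL x y, x \notin separator & y \notin separator].

Definition side : {set LV} := [set x | connect joined (inl (inl a)) x].

(** Invariant carried along [joined]: membership in the component of [a] in G - S, extended to a
    dummy through some endpoint and, in [inv], to a face through some boundary vertex. Outside X the
    choice of endpoint or boundary vertex is immaterial. *)
Let node_inv (x : V + C) :=
  match x with
  | inl u => connect avoid a u
  | inr c => [exists d, (vert d == inr c) &&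
                (if head d is inl u then connect avoid a u else false)]
  end.

Let inv (x : LV) :=
  match x with
  | inl w => node_inv w
  | inr f => [exists d, (froot phi d == val f) && node_inv (vert d)]
  end.

Let node_inv_head d : ~~ hits (vert d) -> ~~ hits (head d) ->
  node_inv (vert d) -> node_inv (head d).
Proof.
case dv: (vert d) => [u|c]; case dh: (head d) => [v|c'] nd nh.
- rewrite /= (@avoid_comp a u v) // /avoid nd nh !andbT.
  exact: adjG_uncrossed dv dh.
- move=> /= ku; apply/existsP; exists (alpha d); rewrite (head_opp plane).
  by rewrite dv ku andbT; apply/eqP.
- case/existsP=> d' /andP[/eqP d'c]; case d'u: (head d') => [u|//] /=.
  by rewrite (unhit_comp a nd d'c dv d'u dh).
- by have [? ] := dummy_head plane dv; rewrite dh.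
Qed.

Let inv_step x y : joined x y -> inv x -> inv y.
Proof.
case/and3P=> adj; rewrite !inE; case: x y adj => [x|f] [y|f'] //.
- case/orP=> [/linkP[d [<- <-]]|]; first exact: node_inv_head.
  case: x y => [u|?] [v|?] //= uv uS vS.
  by rewrite (@avoid_comp a u v) // /avoid uv uS.
- case/orP=> [/existsP[d /andP[/eqP <- df]] _ _ /= ix|]; last by case: x.
  by apply/existsP; exists d; rewrite df.
(* From a face outside X to one of its vertices: no boundary vertex is hit, so the invariant moves
   from corner to corner along [phi]. *)
- case/orP=> [/existsP[d /andP[/eqP <- /eqP df]] nf _ /=|//].
  case/existsP=> d' /andP[/eqP d'f].
  have nh e : froot phi e = val f -> ~~ hits (vert e).
    by move=> ef; apply: contra nf => he; apply/existsP; exists e; rewrite ef eqxx.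
  have: fconnect phi d' d.
    rewrite -(root_connect (fconnect_sym (@phi_inj _ alpha sigma))).
    by rewrite d'f df.
  case/connectP=> p; elim: p d' d'f => [|e p IHp] d' d'f /=; first by move=> _ ->.
  case/andP=> /eqP <- pth ld id'; apply: IHp pth ld _; first by rewrite froot_phi.
  rewrite (vert_phi plane); apply: node_inv_head => //; first exact: nh.
  by rewrite -(vert_phi plane); apply: nh; rewrite froot_phi.
Qed.

Lemma side_avoids : inl (inl b) \notin side.
Proof.
rewrite inE; apply: contra ab => /connectP[p].
rewrite -[connect avoid a b]/(inv (inl (inl b))).
have: inv (inl (inl a)) by exact: connect0.
elim: p (inl (inl a) : LV) => [|y p IHp] x ix; first by move=> _ ->.
by case/andP=> /(inv_step)/(_ ix)/IHp.
Qed.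

Lemma side_separator x : x \in side -> x \notin separator.
Proof.
rewrite inE => /connectP[p]; case/lastP: p => [_ ->|p y]; first by rewrite inE.
by rewrite last_rcons rcons_path => /andP[_ /and3P[_ _ yX]] ->.
Qed.

Lemma separator_triple s : s \in S -> b \notin S ->
  co_separating_triple vert side separator (~: (side :|: separator)).
Proof.
move=> sS bS; split; first split.
- by rewrite -setI_eq0; apply/set0Pn=> -[x /setIP[/side_separator/negPf->]].
- by rewrite disjoints_subset setCK subsetUl.
- by rewrite disjoints_subset setCK subsetUr.
- exact: setUCr.
- split; first by exists a; rewrite inE connect0.
    by exists s; rewrite inE.
  by exists b; rewrite inE in_setU negb_or side_avoids inE.
move=> x y xA; rewrite inE in_setU negb_or => /andP[yA yX].
rewrite -negb_or; apply: contra yA => adj.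
have xX := side_separator xA; move: xA; rewrite !inE => ax.
by apply: (connect_trans ax); apply: connect1; rewrite /joined adj xX.
Qed.

End Triple.

(** * Connectedness of the separator *)

Section Connected.
Variables a b : V.
Hypotheses (aS : a \notin S) (bS : b \notin S).
Hypothesis ab : ~~ connect avoid a b.
Hypothesis minimal : forall s w, s \in S -> w \notin S ->
  exists2 x, connect avoid w x & adjG x s.

Let K := connect avoid a.
Let inK (x : V + C) := if x is inl u then K u else false.

(** The vertex set of the planarization W of K; [iter 2 sigma] passes to the other half of a crossed
    edge. *)
Let drawing : pred (V + C) := fun x =>
  match x with
  | inl u => K u
  | inr c => [exists d, [&& vert d == inr c, inK (head d) &
                            inK (head (iter 2 sigma d))]]
  end.

Let outside : rel (V + C) :=
  [rel x y | [&& link x y, ~~ drawing x & ~~ drawing y]].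

Let Z := connect outside (inl b).

Let outside_sym : symmetric outside.
Proof. by move=> x y; rewrite /outside /= (link_sym plane) [~~ _ && _]andbC. Qed.

Let K_notin u : K u -> u \notin S.
Proof. exact: connect_avoid_notin. Qed.

Let Z_drawing x : Z x -> ~~ drawing x.
Proof.
case/connectP=> p; case/lastP: p => [_ ->|p y] //.
by rewrite last_rcons rcons_path => /andP[_ /and3P[_ _ nd]] ->.
Qed.

Let Z_link x y : link x y -> ~~ drawing x -> ~~ drawing y -> Z x = Z y.
Proof.
move=> xy nx ny; apply: (same_connect1r (sym_connect_sym outside_sym)).
by rewrite /outside /= xy nx.
Qed.

(** The dummy may also lie in W because of the other edge through it; then none of its endpoints is
    in S, and [unhit_comp] puts [p] in K as well. *)
Let drawing_opp d c p q : vert d = inr c -> head d = inl p ->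
  head (iter 2 sigma d) = inl q -> p \notin S -> q \notin S ->
  drawing (inr c) = K p.
Proof.
move=> dc dp dq pS qS.
have Kpq : K p = K q.
  apply: avoid_comp; rewrite /avoid pS qS !andbT.
  exact: (adjG_crossed plane dc dp dq).
apply/existsP/idP=> [[d' /and3P[/eqP d'c]]|Kp]; last first.
  by exists d; rewrite dc eqxx dp dq /= -Kpq Kp.
have [i] := same_vert_iter plane (etrans dc (esym d'c)).
rewrite (dummy_order plane dc) => lti ->; rewrite -iterD.
have [w d1] := dummy_head plane (etrans (vert_iter plane 1 d) dc).
have [x d3] := dummy_head plane (etrans (vert_iter plane 3 d) dc).
have odd_case : K w -> K x -> K p.
  move=> Kw Kx; have nc : ~~ hits (inr c).
    apply/existsP=> -[e /andP[/eqP ec]].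
    have [j] := same_vert_iter plane (etrans dc (esym ec)).
    rewrite (dummy_order plane dc) => + ->.
    move: j => [|[|[|[|j]]]] // _; rewrite ?dp ?d1 ?dq ?d3; apply/negP => //.
      exact: K_notin.
    exact: K_notin.
  by rewrite /K (unhit_comp a nc dc (etrans (vert_iter plane 1 d) dc) dp d1).
move: i lti => [|[|[|[|i]]]] //= _.
- by rewrite dp.
- rewrite -[sigma d]/(iter 1 sigma d) -[sigma (sigma _)]/(iter 3 sigma d) d1 d3.
  exact: odd_case.
- by rewrite -[sigma (sigma d)]/(iter 2 sigma d) dq /= Kpq.
- rewrite -[sigma (sigma (sigma d))]/(iter 3 sigma d).
  rewrite -[sigma (sigma _)]/(iter 1 sigma (iter 4 sigma d)) (dummy_iter4 plane dc) d1 d3.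
  by move=> Kx Kw; apply: odd_case.
Qed.

Let Z_opp d c p q : vert d = inr c -> head d = inl p ->
  head (iter 2 sigma d) = inl q -> p \notin S -> q \notin S ->
  Z (inr c) = Z (inl p).
Proof.
move=> dc dp dq pS qS; have dr := drawing_opp dc dp dq pS qS.
have [Kp|nKp] := boolP (K p).
  rewrite (contraTF (@Z_drawing (inr c))) ?dr //.
  by rewrite (contraTF (@Z_drawing (inl p))).
by apply: Z_link; rewrite ?dr //; apply/linkP; exists d.
Qed.

(** An edge of G - S within K has both ends in W, hence off Z; any other is drawn entirely in G^x -
    W. *)
Let Z_avoid u v : avoid u v -> Z (inl u) = Z (inl v).
Proof.
move=> uv; have Kuv : K u = K v by exact: avoid_comp.
have [Ku|nKu] := boolP (K u).
  rewrite (contraTF (@Z_drawing (inl u))) //.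
  by rewrite (contraTF (@Z_drawing (inl v))) // /= -Kuv.
case/and3P: uv => /(adjGP plane)[[d [du dv]]|[d [c [dc du dv]]]] uS vS.
  by apply: Z_link; rewrite ?/drawing -?Kuv //; apply/linkP; exists d.
rewrite -(Z_opp dc du dv) //.
apply: (@Z_opp (iter 2 sigma d) c v u) => //; first by rewrite (vert_iter plane).
by rewrite -iterD (dummy_iter4 plane dc).
Qed.

Let Z_comp u v : connect avoid u v -> Z (inl u) = Z (inl v).
Proof. by move: u v; apply: connect_const Z_avoid. Qed.

Let cut d := Z (vert d) != Z (head d).

(** If neither end is hit, the edge is all or half of an edge of G - S, along which [Z] is
    constant. *)
Let cut_hits d : cut d -> hits (vert d) || hits (head d).
Proof.
(* Every edge of G^x has an end in V(G), so up to [alpha] the dart starts there. *)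
wlog: d / exists u, vert d = inl u => [wlg|[u du]].
  case dv: (vert d) => [u|c]; first by rewrite -dv; apply: wlg; exists u.
  have [u du] := dummy_head plane dv; move=> cd.
  have := wlg (alpha d); rewrite (head_opp plane) orbC /cut (head_opp plane).
  rewrite eq_sym dv; apply; first by exists u.
  by rewrite -dv.
rewrite /cut; apply: contraR; rewrite negb_or => /andP[].
case dh: (head d) => [v|c]; rewrite du => nu nh; apply/eqP.
  apply: Z_avoid; rewrite /avoid (adjG_uncrossed sigma du dh) /=.
  by apply/andP; split.
have ac : vert (alpha d) = inr c by [].
have au : head (alpha d) = inl u by rewrite (head_opp plane).
have ac2 : vert (iter 2 sigma (alpha d)) = inr c by rewrite (vert_iter plane).
have [v dv] := dummy_head plane ac2.
by rewrite (Z_opp ac au dv) //; apply: unhit_head nh ac2 dv.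
Qed.

(** Minimality gives [s] neighbours in K, which misses Z, and in the component of [b], which lies in
    Z; one of them is on the other side from [s]. If the edge to it is crossed, one half is cut, and
    the dummy is a hit neighbour of [s]. *)
Let cut_near s : s \in S -> exists d, cut d /\
  exists2 x, hits x & (x = inl s \/ link (inl s) x) /\
                      (x = vert d \/ x = head d).
Proof.
move=> sS.
have [x xs Zxs] : exists2 x, adjG x s & Z (inl x) != Z (inl s).
  have [Zs|nZs] := boolP (Z (inl s)).
    have [x ax xs] := minimal sS aS; exists x => //.
    by apply/negP=> /eqP Zx; move: (Z_drawing Zx); rewrite /= -/(K x) /K ax.
  have [x bx xs] := minimal sS bS; exists x => //.
  by rewrite -(Z_comp bx) /Z connect0.
case/(adjGP plane): xs => [[d [dx ds]]|[d [c [dc dx ds]]]].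
  by exists d; rewrite /cut dx ds; split=> //; exists (inl s) => //; split; auto.
have d2c : vert (iter 2 sigma d) = inr c by rewrite (vert_iter plane).
have hc : hits (inr c) by exact: hits_dummy d2c ds sS.
have sc : link (inl s) (inr c).
  by rewrite (link_sym plane); apply/linkP; exists (iter 2 sigma d).
have [Zc|nZc] := eqVneq (Z (inr c)) (Z (inl s)).
  exists d; rewrite /cut dc dx Zc eq_sym; split=> //.
  by exists (inr c); auto.
exists (iter 2 sigma d); rewrite /cut d2c ds; split=> //.
by exists (inr c); auto.
Qed.

Definition in_separator : rel LV :=
  fun x y => adjL x y && (x \in separator) && (y \in separator).

Lemma in_separator_sym : symmetric in_separator.
Proof. by move=> x y; rewrite /in_separator adjL_sym -!andbA [_ && (y \in _)]andbC. Qed.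

Lemma separator_connected :
  {in S &, forall s1 s2, connect in_separator (inl (inl s1)) (inl (inl s2))}.
Proof.
move=> s1 s2 s1S s2S; set o : LV := inl (inl s1).
have csym := sym_connect_sym in_separator_sym.
have c1 x y : x \in separator -> y \in separator -> adjL x y ->
    connect in_separator o x = connect in_separator o y.
  by move=> xX yX xy; apply: (same_connect1r csym); rewrite /in_separator xy xX.
(* [t] selects the edges touching the component of [o] in Lambda[X]. *)
pose near x := hits x && connect in_separator o (inl x).
pose t d := near (vert d) || near (head d).
(* Two hit ends of an edge are adjacent in Lambda[X], so either of them decides [t]. *)
have end_t d x : hits x -> x = vert d \/ x = head d ->
    t d = connect in_separator o (inl x).
  have vh : hits (vert d) -> hits (head d) ->
      connect in_separator o (inl (vert d)) = connect in_separator o (inl (head d)).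
    by move=> hv hh; apply: c1; rewrite ?inE //; apply/linkP; exists d.
  move=> hx xd; rewrite /t /near; case: xd hx => -> hx; rewrite hx /=.
    by case: (boolP (hits (head d))) => [hh|_]; rewrite ?orbF //= -vh ?orbb.
  by case: (boolP (hits (vert d))) => [hv|_] //=; rewrite vh ?orbb.
(* A hit end puts the face into X, so on cut darts [t] is determined by the face, as
   [partial_cut_exact] requires. *)
have t_face d : cut d -> t d = connect in_separator o (inr (face d)).
  have adjh : adjL (inl (head d)) (inr (face d)).
    by rewrite -(vert_phi plane) -face_phi adjL_face.
  have tx x : hits x -> x = vert d \/ x = head d ->
      t d = connect in_separator o (inr (face d)).
    move=> hx xd; rewrite (end_t d x hx xd).
    have xf : adjL (inl x) (inr (face d)).
      by case: xd => -> //; apply: adjL_face.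
    apply: c1 (xf); rewrite inE //.
    case/existsP: xf => e /andP[/eqP ex ef].
    by apply/existsP; exists e; rewrite ef ex.
  by move/cut_hits/orP=> [] h; apply: (tx _ h); auto.
have [h hE] : exists h : V + C -> 'F_2, forall d,
    (cut d && t d)%:R%R = (h (vert d) + h (head d))%R.
  apply: (partial_cut_exact plane connG) => [d|d d' dd' cd cd'].
    by rewrite /t (head_opp plane) orbC.
  by rewrite !t_face //; congr (connect _ _ (inr _)); apply: val_inj.
have h_uncut x y : link x y -> Z x = Z y -> h x = h y.
  case/linkP=> d [<- <-] Zd; have := hE d; rewrite /cut Zd eqxx => /esym/eqP.
  by rewrite F2_add_eq0 => /eqP.
have h_outside x y : connect outside x y -> h x = h y.
  move: x y; apply: connect_const => x y /and3P[xy nx ny].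
  by apply: h_uncut; rewrite // (Z_link xy).
have nZ x : drawing x -> Z x = false.
  by move=> dx; apply: contraTF dx; apply: Z_drawing.
have h_draw x y : link x y -> drawing x -> drawing y -> h x = h y.
  by move=> xy dx dy; apply: h_uncut; rewrite ?nZ.
have h_K u : K u -> h (inl a) = h (inl u).
  move=> Ku; case/connectP: (Ku) => p; have : K a by exact: connect0.
  elim: p (a) => [|w p IHp] v Kv /=; first by move=> _ ->.
  case/andP=> vw pth lst; have Kw : K w by rewrite -[K w](avoid_comp a vw).
  rewrite -(IHp w) //; case/and3P: vw => vw vS wS.
  case/(adjGP plane): vw => [[d [dv dw]]|[d [c [dc dv dw]]]].
    by apply: h_draw => //; apply/linkP; exists d.
  have dr : drawing (inr c) by rewrite (drawing_opp dc dv dw).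
  transitivity (h (inr c)); apply: h_draw => //.
    by rewrite (link_sym plane); apply/linkP; exists d.
  by apply/linkP; exists (iter 2 sigma d); rewrite (vert_iter plane).
have h_drawing x : drawing x -> h (inl a) = h x.
  case: x => [u|c]; first exact: h_K.
  move=> dr; case/existsP: (dr) => d /and3P[/eqP dc].
  case du: (head d) => [u|//] /= Ku _; rewrite (h_K u Ku).
  apply: h_draw => //; rewrite (link_sym plane); apply/linkP.
  by exists d.
have [d1 [cd1 [x1 hx1 [s1x1 x1d]]]] := cut_near s1S.
(* From a vertex off Z and W, walk in G^x up to the first entry into W: the walk stays in G^x - W
   until then, and the entering edge joins two vertices off Z, so it is uncut. *)
have h_nZ x : ~~ Z x -> h (inl a) = h x.
  move=> nZx; have [/h_drawing //|nDx] := boolP (drawing x).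
  have Da : drawing (inl a) by exact: connect0.
  have [y [z [xy yz nDy Dz]]] :=
    connect_exit (link_connected plane connG d1 x (inl a)) nDx Da.
  rewrite (h_drawing z Dz) (h_outside x y xy); apply/esym/h_uncut => //.
  rewrite (nZ z Dz); apply/negbTE; apply: contra nZx => Zy.
  by apply: connect_trans Zy _; rewrite (sym_connect_sym outside_sym).
(* [h] has one value on Z and one off it, so its coboundary, and with it [t], is the same on all cut
   edges; being true near [s1], [t] is true near [s2]. *)
have h_cut d : cut d -> (h (vert d) + h (head d) = h (inl a) + h (inl b))%R.
  rewrite /cut; case Zv: (Z (vert d)); case Zh: (Z (head d)) => // _.
    by rewrite addrC -(h_nZ (head d)) ?Zh // (h_outside (inl b) (vert d)).
  by rewrite -(h_nZ (vert d)) ?Zv // (h_outside (inl b) (head d)).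
have [d2 [cd2 [x2 hx2 [s2x2 x2d]]]] := cut_near s2S.
have conn_near s x : s \in S -> hits x -> x = inl s \/ link (inl s) x ->
    connect in_separator o (inl (inl s)) = connect in_separator o (inl x).
  by move=> sS hx [-> //|sx]; apply: c1; rewrite ?inE.
have t1 : t d1 by rewrite (end_t d1 x1) // -(conn_near s1 x1) ?connect0.
have := hE d2; rewrite (h_cut d2 cd2) -(h_cut d1 cd1) -hE cd1 cd2 t1 /=.
by rewrite (conn_near s2 x2) // -(end_t d2 x2) //; case: (t d2).
Qed.

End Connected.

End Separator.

(** * Minimal separating sets and the equivalence *)

Section Final.
Variables (V C D : finType) (vert : D -> V + C) (alpha sigma : {perm D}).
Hypothesis plane : one_plane_map vert alpha sigma.
Hypothesis connG : G_connected vert alpha sigma.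

Notation adjG := (adjG vert alpha sigma).
Notation separating := (separating vert alpha sigma).

(** Removing s from an inclusion-minimal separating set leaves a non-separating one, so w then
    reaches s; the vertex just before the first visit to s is still joined to w in G - S'. *)
Lemma separating_minimal (S : {set V}) : separating S ->
  exists S' : {set V}, [/\ S' \subset S, separating S' &
    forall s w, s \in S' -> w \notin S' ->
      exists2 x, connect (avoid vert alpha sigma S') w x & adjG x s].
Proof.
pose sepb (S : {set V}) := [exists u, exists v,
  [&& u \notin S, v \notin S & ~~ connect (avoid vert alpha sigma S) u v]].
have sepP S1 : reflect (separating S1) (sepb S1).
  apply: (iffP existsP) => [[u /existsP[v /and3P[? ? ?]]]|[u [v [uS vS uv]]]].
    by exists u, v.
  by exists u; apply/existsP; exists v; rewrite uS vS.
move=> /sepP/minset_exists[S' /minsetP[/sepP sepS' minS'] subS].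
exists S'; split=> // s w sS wS.
have conn : connect (avoid vert alpha sigma (S' :\ s)) w s.
  apply/negPn/negP=> ws; have : sepb (S' :\ s).
    apply/existsP; exists w; apply/existsP; exists s.
    by rewrite !inE eqxx (negPf wS) andbF.
  move/minS'=> /(_ (subD1set _ _)) SE; move: sS.
  by rewrite -SE !inE eqxx.
have ws : w != s by apply: contraNneq wS => ->.
have [x1 [x2 []]] := connect_exit (P := pred1 s) conn ws (eqxx s).
move=> wx1 x12 x1s /eqP x2s.
exists x1; last by rewrite -x2s; case/andP: x12.
apply: connect_sub wx1 => y z /and3P[/and3P[yz yS zS] /negPf/= ys /negPf/= zs].
by apply: connect1; move: yS zS; rewrite /avoid yz !inE ys zs => -> ->.
Qed.

Lemma separating_nonempty (S : {set V}) : separating S -> exists s, s \in S.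
Proof.
case=> u [v [_ _ uv]]; apply/set0Pn; apply: contra uv => /eqP ->.
by apply: connect_sub (connG u v) => x y xy; apply: connect1; rewrite xy !inE.
Qed.

(** The bound r is 1 on all of G^x, even on S itself, and 2 on faces. As two faces are never
    adjacent, r sums to at most 3 along every edge, as [diameter_bound] requires. *)
Lemma separator_near (S : {set V}) x : x \in separator vert alpha sigma S ->
  let r := if x is inr _ then 2 else 1 in
  r <= 2 /\ exists2 s, s \in [set inl (inl v) | v in S] &
    within (in_separator vert S) r x s.
Proof.
pose X := separator vert alpha sigma S.
have nearN w : hits vert alpha S w ->
    exists2 s, s \in [set (inl (inl v) : LV V C alpha sigma) | v in S] &
      within (in_separator vert S) 1 (inl w) s.
  move=> hw; have wX : inl w \in X by rewrite inE.
  case: w hw wX => [u|c] hw wX.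
    exists (inl (inl u)); first exact: imset_f.
    exact: within_le (leq0n 1) (within0 _ _).
  case/existsP: hw => d /andP[/eqP dc]; case ds: (Defs.head vert alpha d) => [s|//] sS.
  exists (inl (inl s)); first exact: imset_f.
  have sX : inl (inl s) \in X by rewrite inE.
  apply: within1; rewrite /in_separator wX sX !andbT.
  by apply/linkP; exists d.
case: x => [w|f] fX /=; split=> //; first by apply: nearN; rewrite inE in fX.
move: (fX); rewrite inE => /existsP[d /andP[/eqP df hd]].
have [s sS ds] := nearN _ hd; exists s => //.
apply: (within_trans (m := 1) _ ds); apply: within1.
have dX : inl (vert d) \in X by rewrite inE.
rewrite /in_separator fX dX !andbT.
by apply/existsP; exists d; rewrite df !eqxx.
Qed.

(** As no edge of G joins A to B, a path of G that starts in A and avoids X never leaves A. *)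
Lemma co_separating_separates (A X B : {set LV V C alpha sigma}) :
  co_separating_triple vert A X B -> separating [set v | inl (inl v) \in X].
Proof.
case=> [[/pred0P AX /pred0P AB /pred0P XB cover]].
case=> [[u uA] _ [v vB]] noedge; exists u, v; rewrite !inE.
split; first by apply/negP=> uX; have := AX (inl (inl u)); rewrite /= uA uX.
  by apply/negP=> vX; have := XB (inl (inl v)); rewrite /= vB vX.
apply/connectP=> -[p].
elim: p u uA => [|w p IHp] u uA /=.
  by move=> _ vu; have := AB (inl (inl v)); rewrite /= vB vu uA.
case/andP=> /and3P[uw _]; rewrite inE => wX; apply: IHp.
have : inl (inl w) \in A :|: X :|: B by rewrite cover inE.
rewrite !in_setU (negPf wX) orbF => /orP[//|wB].
by have /andP[_] := noedge _ _ uA wB; rewrite /adjGL uw.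
Qed.

End Final.

Theorem theorem2 (V C D : finType) (vert : D -> V + C) (alpha sigma : {perm D})
    (k : nat) :
  @one_plane_map V C D vert alpha sigma ->
  @G_connected V C D vert alpha sigma ->
  @no_x_crossings V C D vert alpha sigma ->
  @kite_assumption V C D vert alpha sigma ->
  1 <= k ->
  (exists S : {set V}, #|S| <= k /\ @separating V C D vert alpha sigma S) <->
  (exists A X B : {set @LV V C D alpha sigma},
      [/\ @co_separating_triple V C D vert alpha sigma A X B,
          #|[set v : V | inl (inl v) \in X]| <= k &
          @induced_diam_le V C D vert alpha sigma X (4 * k)]).
Proof.
move=> plane connG no_x _ _; split; last first.
  case=> A [X [B [triple leX _]]].
  exists [set v | inl (inl v) \in X]; split=> //.
  exact: co_separating_separates triple.
case=> S0 [leS0 /separating_minimal[S [subS sepS minS]]].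
have leS : #|S| <= k := leq_trans (subset_leq_card subS) leS0.
have [s sS] := separating_nonempty connG sepS.
case: sepS => a [b [aS bS ab]].
exists (side vert alpha sigma S a), (separator vert alpha sigma S),
  (~: (side vert alpha sigma S a :|: separator vert alpha sigma S)); split.
- exact: separator_triple sS bS.
- by apply: leq_trans leS; rewrite subset_leq_card //; apply/subsetP=> v; rewrite !inE.
move=> x y xX yX.
have /withinP[p [pth lst sz]] : within (in_separator vert S)
    (4 * #|[set (inl (inl v) : LV V C alpha sigma) | v in S]|) x y.
  apply: (diameter_bound (X := separator vert alpha sigma S)
    (in_separator_sym plane S) _ _ (separator_near (S := S))) => //.
  - move=> _ _ /imsetP[v vS ->] /imsetP[w wS ->].
    exact: (separator_connected plane connG no_x aS bS ab).
  - by move=> ? ? /andP[].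
  - by case=> [?|?] [?|?].
exists p; split=> //; apply: leq_trans sz _.
by rewrite leq_mul2l (leq_trans (leq_imset_card _ _) leS).
Qed.
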